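(* The set of identities $J_3$ is finitely based by $\bigl(\Gamma\cup\Sigma\cup\Delta\bigr)^\delta$, where $$\Gamma=\{xt_1xt_2x\approx xt_1xxt_2x,\ \ xt_1yxxt_2y\approx xt_1xyxxt_2y,\ \ yt_1xxyt_2x\approx yt_1xxyxt_2x\},$$ $$\Sigma=\{xyxytxty\approx yxyxtxty,\ \ xtytxyxy\approx xtytyxyx\},$$ $$\Delta=\{xtytxytxty\approx xtytyxtxty,\ \ xtytxytytx\approx xtytyxtytx\};$$ in $\Sigma$ and $\Delta$ different occurrences of the letter $t$ within a word represent distinct linear variables, with the $j$-th occurrence of $t$ on the left representing the same variable as the $j$-th occurrence of $t$ on the right. That is, all these identities belong to $J_3$ and every identity in $J_3$ can be derived from them.
   Context: Variables are elements of a countable alphabet, words are elements of the free semigroup over it; an identity is $\mathbf u\approx\mathbf v$ with $\mathbf u,\mathbf v$ words; derivations are in the equational logic of semigroups. A word $x_1x_2\cdots x_k$ is a scattered subword of $\mathbf v$ if $\mathbf v=\mathbf v_0x_1\mathbf v_1x_2\mathbf v_2\cdots x_k\mathbf v_k$ for some possibly empty words $\mathbf v_0,\dots,\mathbf v_k$. $J_m$ denotes the set of all identities $\mathbf u\approx\mathbf v$ such that $\mathbf u$ and $\mathbf v$ have the same set of scattered subwords of length $\le m$. A variable is linear in a word if it occurs in it exactly once. For a set $\mathfrak X$ of variables, $\mathbf u(\mathfrak X)$ is the word obtained from $\mathbf u$ by deleting all occurrences of variables not in $\mathfrak X$. For a set $\Theta$ of identities, $\Theta^\delta$ is its closure under deleting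 variables: all identities $\mathbf u(\mathfrak X)\approx\mathbf v(\mathfrak X)$ with $(\mathbf u\approx\mathbf v)\in\Theta$ and $\mathfrak X$ a set of variables. *)

(* Defs.v *)
From mathcomp Require Import all_boot.
From mathcomp Require Import boolp classical_sets cardinality.

Set Implicit Arguments.
Unset Strict Implicit.
Unset Printing Implicit Defensive.

Local Open Scope classical_set_scope.

Definition var := nat.

(* Elements of the free semigroup over [var] are the nonempty words; the empty
   word is in the type only because deleting variables may produce it. *)
Definition word := seq var.

(* The pair [(u, v)] stands for the identity u ~ v. *)
Definition identity := (word * word)%type.

Definition is_identity (e : identity) : bool := (e.1 != [::]) && (e.2 != [::]).

(* Equational logic of semigroups: substitutions replace variables by nonempty
   words. *)
Definition subst (phi : var -> word) (u : word) : word := flatten (map phi u).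

Inductive derives (Theta : set identity) : word -> word -> Prop :=
| derives_axiom u v : Theta (u, v) -> derives Theta u v
| derives_refl u : u != [::] -> derives Theta u u
| derives_sym u v : derives Theta u v -> derives Theta v u
| derives_trans u v w :
    derives Theta u v -> derives Theta v w -> derives Theta u w
| derives_mul u1 v1 u2 v2 :
    derives Theta u1 v1 -> derives Theta u2 v2 ->
    derives Theta (u1 ++ u2) (v1 ++ v2)
| derives_subst (phi : var -> word) u v :
    (forall z, phi z != [::]) ->
    derives Theta u v -> derives Theta (subst phi u) (subst phi v).

(* Scattered subwords of [u] are the [w] with [subseq w u]. *)
Definition J (m : nat) : set identity :=
  [set e | is_identity e /\
           forall w : word, size w <= m -> subseq w e.1 = subseq w e.2].

Definition restrict (X : set var) (u : word) : word := [seq z <- u | z \in X].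

(* [is_identity] discards the pairs with an empty side, which are not
   semigroup identities. *)
Definition delta (Theta : set identity) : set identity :=
  [set e | is_identity e /\
     exists (u v : word) (X : set var),
       Theta (u, v) /\ e = (restrict X u, restrict X v)].

Definition finitely_based_by (I B : set identity) : Prop :=
  [/\ finite_set B, B `<=` I & forall u v, I (u, v) -> derives B u v].

Local Notation x := 0%N (only parsing).
Local Notation y := 1%N (only parsing).
Local Notation t1 := 2%N (only parsing).
Local Notation t2 := 3%N (only parsing).
Local Notation t3 := 4%N (only parsing).
Local Notation t4 := 5%N (only parsing).

Definition Gamma : set identity :=
  [set ([:: x; t1; x; t2; x], [:: x; t1; x; x; t2; x]);
       ([:: x; t1; y; x; x; t2; y], [:: x; t1; x; y; x; x; t2; y]);
       ([:: y; t1; x; x; y; t2; x], [:: y; t1; x; x; y; x; t2; x])].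

Definition Sigma : set identity :=
  [set ([:: x; y; x; y; t1; x; t2; y], [:: y; x; y; x; t1; x; t2; y]);
       ([:: x; t1; y; t2; x; y; x; y], [:: x; t1; y; t2; y; x; y; x])].

Definition Delta : set identity :=
  [set ([:: x; t1; y; t2; x; y; t3; x; t4; y],
        [:: x; t1; y; t2; y; x; t3; x; t4; y]);
       ([:: x; t1; y; t2; x; y; t3; y; t4; x],
        [:: x; t1; y; t2; y; x; t3; y; t4; x])].

(* Main.v *)
(** Two words with the same scattered subwords of length at most 3 are joined
    by a chain of one-letter insertions that keep these subwords (Simon): if
    [uav ~ ubw] with [a <> b], then [uav ~ ubav] or [ubw ~ uabw], and in both
    cases the common prefix of the two words grows.  An insertion [uv ~ uxv] of
    this kind splits as [u ~_p ux] and [v ~_q xv] with [p + q = 3], where [~_p]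
    compares the subwords of length at most [p].  The cases [(2,1)] and [(3,0)]
    follow from the first and third identities of [Gamma] and the second one of
    [Sigma]; the cases [(1,2)] and [(0,3)] are their mirror images. *)
Require Import Defs.
From mathcomp Require Import all_boot.
From mathcomp Require Import boolp classical_sets cardinality.

Set Implicit Arguments.
Unset Strict Implicit.
Unset Printing Implicit Defensive.

Local Open Scope classical_set_scope.

(** * Scattered subwords of a product *)

Lemma subseq_catP {T : eqType} {w u v : seq T} :
  reflect (exists w1 w2, [/\ w = w1 ++ w2, subseq w1 u & subseq w2 v])
          (subseq w (u ++ v)).
Proof.
apply: (iffP idP) => [|[w1 [w2 [-> s1 s2]]]]; last exact: cat_subseq.
case/subseqP=> m; rewrite size_cat -{2}(cat_take_drop (size u) m) => sz_m ->.
exists (mask (take (size u) m) u), (mask (drop (size u) m) v).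
by rewrite mask_cat ?mask_subseq // size_takel // sz_m leq_addr.
Qed.

(** The part embedded in [u] is no longer than [s], since otherwise it would begin with [rcons s x];
    so all of [x :: s'] falls into [v]. *)
Lemma subseq_cat_tail {T : eqType} {s s' u v : seq T} {x : T} :
  ~~ subseq (rcons s x) u -> subseq (s ++ x :: s') (u ++ v) ->
  subseq (x :: s') v.
Proof.
move=> sxu /subseq_catP[w1 [w2 [def_w s1 s2]]].
have [le_w1 | lt_s] := leqP (size w1) (size s).
  apply: subseq_trans s2; have := congr1 (drop (size w1)) def_w.
  rewrite (drop_size_cat w2 (erefl _)) -[s](cat_take_drop (size w1)).
  by rewrite -catA drop_size_cat ?size_takel // => <-; apply: suffix_subseq.
case/negP: sxu; apply: subseq_trans s1.
have := congr1 (take (size s).+1) def_w.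
rewrite (takel_cat _ lt_s) -cat_rcons take_size_cat ?size_rcons // => ->.
exact: take_subseq.
Qed.

Lemma subseq_rcons_last {T : eqType} {s u w : seq T} {x : T} :
  x \notin w -> subseq (rcons s x) (u ++ x :: w) -> subseq s u.
Proof.
move=> xw; rewrite -cat_rcons => sx; apply: contraNT xw => su.
rewrite -sub1seq; rewrite -cats1 in sx; apply: subseq_cat_tail sx.
by apply: contra su; rewrite -!cats1 subseq_cat2r.
Qed.

Lemma subseq_last {T : eqType} {x : T} {u : seq T} :
  x \in u -> exists u' w, u = u' ++ x :: w /\ x \notin w.
Proof.
elim: u => // a u IHu; have [/IHu[u' [w [-> xw]]] _ | xu] := boolP (x \in u).
  by exists (a :: u'), w.
by rewrite inE (negPf xu) orbF => /eqP <-; exists [::], u.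
Qed.

(** * Absorbed letters *)

(* This is [u ~_p ux]: only the subwords that end in the new [x] can be new. *)
Definition absorbs (p : nat) (u : word) (x : var) :=
  forall s, size s < p -> subseq s u -> subseq (rcons s x) u.

Lemma absorbs_mem p u x : absorbs p.+1 u x -> x \in u.
Proof. by move=> /(_ [::] isT (sub0seq u)); rewrite sub1seq. Qed.

(** A short subword ending in the appended [z] occurs in [u] already, because [u] absorbs [z]. *)
Lemma absorbs_rcons p u x z :
  absorbs p u z -> absorbs p u x -> absorbs p (rcons u z) x.
Proof.
move=> zu xu s lt_s; rewrite -cats1 => /subseq_catP[s1 [s2 [def_s s1u s2z]]].
apply: subseq_trans (prefix_subseq _ _); apply: xu => //.
case: s2 s2z def_s => [_|c [|d s2]]; first by rewrite cats0 => ->.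
  2: by move/size_subseq.
rewrite sub1seq mem_seq1 => /eqP-> def_s; rewrite def_s cats1; apply: zu => //.
by rewrite (leq_trans _ lt_s) // def_s size_cat addn1.
Qed.

Lemma absorbs_cat p u w x :
  absorbs p u x -> {in w, forall z, absorbs p u z} -> absorbs p (u ++ w) x.
Proof.
elim/last_ind: w x => [|w z IHw] x xu wu; first by rewrite cats0.
have wu' : {in w, forall t, absorbs p u t}.
  by move=> t tw; apply: wu; rewrite mem_rcons inE tw orbT.
rewrite -rcons_cat; apply: absorbs_rcons; apply: IHw => //.
by apply: wu; rewrite mem_rcons mem_head.
Qed.

(** A final [x] is matched no later than the last [x] of the word, so whatever precedes it lies in
    [u]. *)
Lemma absorbs_last {p u w x} :
  x \notin w -> absorbs p.+1 (u ++ x :: w) x ->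
  forall s, size s <= p -> subseq s (u ++ x :: w) -> subseq s u.
Proof. by move=> xw xu s le_s su; apply: subseq_rcons_last xw _; apply: xu. Qed.

(** * Insertions obtained from three rewriting schemes *)

(** Keeping [R] abstract lets one argument serve both derivability and its mirror image. *)
Record insertion_theory (R : word -> word -> Prop) : Prop := InsertionTheory {
  ins_refl : forall u, R u u;
  ins_sym : forall u v, R u v -> R v u;
  ins_trans : forall u v w, R u v -> R v w -> R u w;
  ins_double : forall (a b : word) (x : var), x \in a -> x \in b ->
    R (a ++ x :: b) (a ++ [:: x, x & b]);
  ins_after : forall (a b : word) (x y : var), y \in a -> x \in b ->
    R (a ++ [:: x, x, y & b]) (a ++ [:: x, x, y, x & b]);
  ins_swap : forall (a b : word) (x y : var), subseq [:: x; y] a ->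
    R (a ++ [:: x, y, x, y & b]) (a ++ [:: y, x, y, x & b]) }.

Lemma mem2_subseq (a : word) (x y : var) :
  x \in a -> y \in a -> [\/ x = y, subseq [:: x; y] a | subseq [:: y; x] a].
Proof.
move=> xa ya; have [->|xy] := eqVneq x y; first by constructor.
case/splitPr: xa ya => a1 a2; rewrite mem_cat inE eq_sym (negPf xy) /=.
case/orP=> yi; [constructor 3 | constructor 2].
  by apply: (@cat_subseq _ [:: y] [:: x]); rewrite sub1seq ?mem_head.
apply: subseq_trans (suffix_subseq _ _).
by rewrite /= eqxx sub1seq.
Qed.

Section Insertion.

Context {R : word -> word -> Prop} (RP : insertion_theory R).

Let swap (a b : word) (x y : var) : x \in a -> y \in a ->
  R (a ++ [:: x, y, x, y & b]) (a ++ [:: y, x, y, x & b]).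
Proof.
move=> xa ya; have [-> | | ] := mem2_subseq xa ya.
- exact: (ins_refl RP).
- exact: (ins_swap RP).
- by move=> s; apply/(ins_sym RP)/(ins_swap RP).
Qed.

(** The new [x] is carried through [w] letter by letter: [R_xy] puts an [x] behind the first letter
    on both sides, and the induction continues from that [x]. *)
Lemma insert_after_block (a w b : word) (x : var) :
  x \in a -> {subset w <= a} -> x \in b ->
  R (a ++ x :: w ++ b) (a ++ x :: w ++ x :: b).
Proof.
elim: w a => [|y w IHw] a xa wa xb /=; first exact: (ins_double RP).
have xwb : x \in w ++ b by rewrite mem_cat xb orbT.
have ya : y \in a by rewrite wa ?mem_head.
(* The chain is [xy], [xxy], [xxyx], [xyx]: doubling [x] creates the pattern of [ins_after]. *)
have R_xy c : x \in c -> R (a ++ [:: x, y & c]) (a ++ [:: x, y, x & c]).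
  move=> xc; apply: (ins_trans RP (ins_double RP xa _)).
    by rewrite inE xc orbT.
  apply: (ins_trans RP (ins_after RP ya xc)).
  by apply: (ins_sym RP); apply: (ins_double RP) => //; rewrite !inE eqxx orbT.
apply: (ins_trans RP (R_xy _ xwb)); apply: (ins_sym RP).
have xwxb : x \in w ++ x :: b by rewrite mem_cat mem_head orbT.
apply: (ins_trans RP (R_xy _ xwxb)); apply: (ins_sym RP).
have := IHw (a ++ [:: x; y]); rewrite -!catA; apply=> //.
  by rewrite mem_cat xa.
by move=> z zw; rewrite mem_cat wa // inE zw orbT.
Qed.

(** Every letter from the last [x] of [u] onwards also occurs before it, so these letters form a
    block for [insert_after_block]. *)
Lemma insert21 (u v : word) (x : var) :
  absorbs 2 u x -> x \in v -> R (u ++ v) (u ++ x :: v).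
Proof.
move=> xu2 xv; have [u' [w [def_u xw]]] := subseq_last (absorbs_mem xu2).
rewrite def_u in xu2 *.
have u'P z : z \in x :: w -> z \in u'.
  move=> zxw; rewrite -sub1seq; apply: (absorbs_last xw xu2) => //.
  by rewrite sub1seq mem_cat zxw orbT.
rewrite -!catA !cat_cons; apply: insert_after_block => //.
  by rewrite u'P ?mem_head.
by move=> z zw; rewrite u'P // inE zw orbT.
Qed.

(** Here [x] may be missing from [v], so [ins_after] does not suffice and [swap] carries [x] past a
    letter. *)
Lemma insert_end_block (u w v : word) (x : var) :
  absorbs 2 u x -> {in w, forall z, absorbs 2 u z} ->
  R (u ++ x :: w ++ v) (u ++ x :: w ++ x :: v).
Proof.
elim: w u => [|y w IHw] u xu wu.
  by apply: insert21 => //; rewrite mem_head.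
have yu : absorbs 2 u y by apply: wu; rewrite mem_head.
(* Inserting [y] and then [x] in front turns [xy] into [xyxy]; [swap] gives [yxyx], and removing the
   leading [y] gives [xyx]. *)
have R_xy c : R (u ++ [:: x, y & c]) (u ++ [:: x, y, x & c]).
  have [xm ym] := (absorbs_mem xu, absorbs_mem yu).
  have xyxy : R (u ++ [:: x, y & c]) (u ++ [:: x, y, x, y & c]).
    apply: (ins_trans RP (insert21 (v := [:: x, y & c]) yu _)).
      by rewrite !inE eqxx orbT.
    by apply: insert21 => //; rewrite !inE eqxx orbT.
  apply: (ins_trans RP xyxy).
  apply: (ins_trans RP (swap _ xm ym)); apply: (ins_sym RP).
  by apply: insert21 => //; rewrite !inE eqxx orbT.
rewrite !cat_cons; apply: (ins_trans RP (R_xy _)); apply: (ins_sym RP).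
apply: (ins_trans RP (R_xy _)); apply: (ins_sym RP).
have xyu z : z \in [:: x; y] -> absorbs 2 u z by rewrite !inE => /orP[] /eqP->.
have := IHw (u ++ [:: x; y]); rewrite -!catA; apply.
  exact: absorbs_cat.
by move=> z zw; apply: absorbs_cat => //; apply: wu; rewrite inE zw orbT.
Qed.

Lemma insert30 (u v : word) (x : var) : absorbs 3 u x -> R (u ++ v) (u ++ x :: v).
Proof.
move=> xu3; have [u' [w [def_u xw]]] := subseq_last (absorbs_mem xu3).
rewrite def_u in xu3 *.
have u'P z : z \in x :: w -> absorbs 2 u' z.
  move=> zxw s lt_s su'; apply: (absorbs_last xw xu3); rewrite ?size_rcons //.
  by rewrite -cats1 cat_subseq // sub1seq.
rewrite -!catA !cat_cons; apply: insert_end_block.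
  by apply: u'P; rewrite mem_head.
by move=> z zw; apply: u'P; rewrite inE zw orbT.
Qed.

End Insertion.

(** * Simon's congruence and one-letter insertions *)

Definition sim (m : nat) (u v : word) :=
  forall w : word, size w <= m -> subseq w u = subseq w v.

Lemma sim_sym m u v : sim m u v -> sim m v u.
Proof. by move=> uv w /uv. Qed.

Lemma sim_trans m u v w : sim m u v -> sim m v w -> sim m u w.
Proof. by move=> uv vw z sz; rewrite uv // vw. Qed.

(** Take [p] maximal. If [p < m], some [s] of length at most [p] lies in [u] while [sx] does not.
    For a short suffix part [s'] of [v], the word [sxs'] is then a subword of [uv], which forces
    [xs'] into [v]. *)
Lemma sim_insert_split m (u v : word) (x : var) : sim m (u ++ v) (u ++ x :: v) ->
  exists p, [/\ p <= m, absorbs p u x & absorbs (m - p) (rev v) x].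
Proof.
move=> uv; have ex0 : exists p, (p <= m) && `[< absorbs p u x >].
  by exists 0; rewrite leq0n; apply/asboolP => s.
have ub p : (p <= m) && `[< absorbs p u x >] -> p <= m by case/andP.
case: (ex_maxnP ex0 ub) => p /andP[le_pm /asboolP xu] maxp.
exists p; split=> // s' lt_s'; rewrite -subseq_rev revK => s'v.
rewrite -subseq_rev revK rev_rcons.
have lt_pm : p < m by rewrite -subn_gt0 (leq_trans _ lt_s').
have /existsNP[s /not_implyP[lt_s /not_implyP[su /negP sxu]]] :
    ~ absorbs p.+1 u x.
  by move=> xup; have := maxp p.+1; rewrite lt_pm asboolT // ltnn => /(_ isT).
apply: (subseq_cat_tail sxu); rewrite uv; first by rewrite cat_subseq //= eqxx.
by rewrite size_cat /= size_rev -(subnKC le_pm) leq_add.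
Qed.

Lemma not_sim_insert m (u v : word) (x : var) :
  ~ sim m (u ++ v) (u ++ x :: v) ->
  exists s s', [/\ size s + size s' < m, subseq s u, subseq s' v
                 & ~~ subseq (s ++ x :: s') (u ++ v)].
Proof.
move=> nuv; apply: contrapT => nex; apply: nuv => w le_w.
apply/idP/idP => [wuv|].
  by apply: subseq_trans wuv _; rewrite subseq_cat2l subseq_cons.
case/subseq_catP=> s [[|c s'] [def_w su]].
  by rewrite def_w cats0 => _; apply: subseq_trans su (prefix_subseq _ _).
rewrite {}def_w in le_w *; rewrite /=.
case: eqP => [-> s'v | _ s'v]; last exact: cat_subseq.
apply: contrapT => /negP sxs'; apply: nex; exists s, s'; split=> //.
by rewrite size_cat addnS in le_w.
Qed.

(** The words [sbs'] and [rar'] witness that neither insertion is allowed. Since [ra] is not in [u],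
    comparing [rat] on both sides moves short subwords [t] of [v] into [w]. If [r] and [s'] were
    short together, [s'] would lie in [w], and [sbs'] in both words. *)
Lemma fork_contra m (u v w s s' r r' : word) (a b : var) :
  a != b -> sim m (u ++ a :: v) (u ++ b :: w) ->
  [/\ size s + size s' < m, subseq s u, subseq s' (a :: v)
    & ~~ subseq (s ++ b :: s') (u ++ a :: v)] ->
  [/\ size r + size r' < m, subseq r u, subseq r' (b :: w)
    & ~~ subseq (r ++ a :: r') (u ++ b :: w)] ->
  m <= size r + size s'.
Proof.
move=> ab fg [lt_s su s'v sbs'] [lt_r ru r'w rar']; rewrite leqNgt.
apply: contra sbs' => lt_rs.
have rau : ~~ subseq (rcons r a) u.
  by apply: contra rar' => rau; rewrite -cat_rcons cat_subseq.
rewrite fg; last by rewrite size_cat addnS.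
rewrite cat_subseq //= eqxx.
have tail t : size r + size t < m -> subseq t v -> subseq (a :: t) w.
  move=> lt_t tv; have : subseq (r ++ a :: t) (u ++ b :: w).
    by rewrite -fg ?size_cat ?addnS // cat_subseq //= eqxx.
  by move/(subseq_cat_tail rau); rewrite /= (negPf ab).
case: s' s'v lt_rs {lt_s} => [|c s']; first by move=> *; apply: sub0seq.
rewrite [subseq _ _]/=; case: eqP => [-> s'v lt_rs | _ s'v lt_rs].
  by apply: tail => //; apply: leq_trans lt_rs; rewrite addnS.
exact: subseq_trans (subseq_cons _ a) (tail _ lt_rs s'v).
Qed.

Lemma sim_fork m (u v w : word) (a b : var) :
  a != b -> sim m (u ++ a :: v) (u ++ b :: w) ->
  sim m (u ++ a :: v) (u ++ b :: a :: v) \/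
  sim m (u ++ b :: w) (u ++ a :: b :: w).
Proof.
move=> ab fg; apply: contrapT => /not_orP[/not_sim_insert[s [s' sP]]].
case/not_sim_insert=> r [r' rP].
(* The two crossed lower bounds add up to [m + m], against the upper bounds in [sP] and [rP]. *)
have le_rs := fork_contra ab fg sP rP.
rewrite eq_sym in ab; have le_sr := fork_contra ab (sim_sym fg) rP sP.
case: sP rP => lt_s _ _ _ [lt_r _ _ _].
suff: m + m < m + m by rewrite ltnn.
apply: leq_ltn_trans (leq_add le_rs le_sr) _.
by rewrite addnACA (addnC (size r)) addnACA -addSn leq_add // ltnW.
Qed.

Lemma sim_insertions (R : word -> word -> Prop) m :
  (forall u, R u u) -> (forall u v, R u v -> R v u) ->
  (forall u v w, R u v -> R v w -> R u w) ->
  (forall (u v : word) (x : var),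
     sim m (u ++ v) (u ++ x :: v) -> R (u ++ v) (u ++ x :: v)) ->
  forall u v, sim m u v -> R u v.
Proof.
move=> Rrefl Rsym Rtrans Rins u v; suff H n : forall u v w : word,
    size v + size w <= n -> sim m (u ++ v) (u ++ w) -> R (u ++ v) (u ++ w).
  exact: (H _ [::] u v (leqnn _)).
(* When one tail is empty, [u'b] lies between [u'] and [u'bw] and hence has the same short
   subwords. *)
have nil_cons n' u' b w : (forall u v w : word,
    size v + size w <= n' -> sim m (u ++ v) (u ++ w) -> R (u ++ v) (u ++ w)) ->
    size w <= n' -> sim m u' (u' ++ b :: w) -> R u' (u' ++ b :: w).
  move=> IHn le_n uw.
  have ub : sim m (u' ++ [::]) (u' ++ [:: b]).
    rewrite cats0 => z le_z; apply/idP/idP => [zu|zub].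
      exact: subseq_trans zu (prefix_subseq _ _).
    rewrite uw //; apply: subseq_trans zub _.
    by rewrite subseq_cat2l /= eqxx sub0seq.
  have := Rins _ _ _ ub; rewrite cats0 in ub *; move/Rtrans; apply.
  have := IHn (rcons u' b) [::] w le_n; rewrite cats0 cat_rcons -cats1; apply.
  exact: sim_trans (sim_sym ub) uw.
elim: n {u v} => [|n IHn] u [|a v] [|b w] //= le_n fg; rewrite ?cats0.
- by apply: nil_cons IHn _ _; rewrite ?cats0 in fg.
- apply/Rsym/(nil_cons n) => //; first by rewrite addn0 in le_n.
  by rewrite cats0 in fg; apply: sim_sym.
rewrite addSn addnS ltnS in le_n.
have [ab | ab] := eqVneq a b.
  by rewrite -ab -!cat_rcons in fg *; apply: IHn _ fg; apply: ltnW.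
have le_nS : (size v).+1 + size w <= n by [].
have [fb | ga] := sim_fork ab fg.
  apply: Rtrans (Rins _ _ _ fb) _.
  have := IHn (rcons u b) (a :: v) w; rewrite !cat_rcons; apply=> //.
  exact: sim_trans (sim_sym fb) fg.
apply/Rsym/(Rtrans _ _ _ (Rins _ _ _ ga)).
have := IHn (rcons u a) (b :: w) v; rewrite !cat_rcons; apply.
  by rewrite /= addnC addnS.
exact: sim_trans (sim_sym ga) (sim_sym fg).
Qed.

Lemma insertion_complete (R : word -> word -> Prop) :
  insertion_theory R -> insertion_theory (fun u v => R (rev u) (rev v)) ->
  forall u v, sim 3 u v -> R u v.
Proof.
move=> RP RrP.
apply: sim_insertions;
  [exact: ins_refl | exact: ins_sym | exact: ins_trans | ].
move=> u v x /sim_insert_split[p [le_p xu xv]].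
(* For [p] at most 1 the suffix absorbs more, so the insertion is read from right to left. *)
have mirror : R (rev (rev v ++ rev u)) (rev (rev v ++ x :: rev u)) ->
    R (u ++ v) (u ++ x :: v).
  by rewrite !rev_cat rev_cons !revK cat_rcons.
case: p le_p xu xv => [|[|[|[|//]]]] _ xu xv.
- by apply: mirror; apply: (insert30 RrP).
- by apply: mirror; apply: (insert21 RrP) => //; rewrite mem_rev (absorbs_mem xu).
- by apply: (insert21 RP) => //; rewrite -mem_rev (absorbs_mem xv).
- exact: (insert30 RP).
Qed.

(** * Derivability with erasing substitutions *)

(** Equality is added because [derives_refl] excludes the empty word. *)
Definition equivalent (Theta : set identity) (u v : word) :=
  u = v \/ derives (delta Theta) u v.

Lemma equivalent_sym Theta u v : equivalent Theta u v -> equivalent Theta v u.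
Proof. by case=> [->|uv]; [left | right; apply: derives_sym]. Qed.

Lemma equivalent_trans Theta u v w :
  equivalent Theta u v -> equivalent Theta v w -> equivalent Theta u w.
Proof.
case=> [->|uv] // [<-|vw]; first by right.
by right; apply: derives_trans vw.
Qed.

Lemma equivalent_cat Theta (a b u v : word) :
  equivalent Theta u v -> equivalent Theta (a ++ u ++ b) (a ++ v ++ b).
Proof.
case=> [->|uv]; first by left.
have uvb : derives (delta Theta) (u ++ b) (v ++ b).
  case: b => [|c b]; first by rewrite !cats0.
  by apply: derives_mul => //; apply: derives_refl.
case: a => [|c a]; right=> //.
by apply: derives_mul => //; apply: derives_refl.
Qed.

(* Here [phi] may erase variables: [delta Theta] contains the identities with
   these variables deleted. *)
Lemma equivalent_subst m Theta : Theta `<=` J m.+1 ->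
  forall (p q : word) (phi : var -> word) (a b : word),
  Theta (p, q) ->
  equivalent Theta (a ++ subst phi p ++ b) (a ++ subst phi q ++ b).
Proof.
move=> ThJ p q phi a b pq; apply: equivalent_cat.
have eq_pq : p =i q.
  by move=> z; have [_ sim_pq] := ThJ _ pq; rewrite -!sub1seq sim_pq.
pose X := [set z | phi z != [::]].
(* The value [[:: z]] only keeps [phi'] nonerasing: such [z] are deleted by [restrict X]. *)
pose phi' z := if phi z == [::] then [:: z] else phi z.
have substX u : subst phi u = subst phi' (restrict X u).
  elim: u => // z u IHu; rewrite /subst /= -/(subst phi u) IHu.
  have -> : (z \in X) = (phi z != [::]) by apply/idP/idP; rewrite inE.
  have [-> // | phiz] := eqVneq (phi z) [::].
  by rewrite /subst /= {2}/phi' (negPf phiz).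
have phi'_neq0 z : phi' z != [::] by rewrite /phi'; case: ifP => // ->.
have restrict0 u : (restrict X u != [::]) = has (fun z => z \in X) u.
  by rewrite has_filter.
rewrite !substX.
have [p0 | p0] := eqVneq (restrict X p) [::].
  have : restrict X q == [::].
    by apply/negPn; rewrite restrict0 -(eq_has_r eq_pq) -restrict0 p0.
  by rewrite p0 => /eqP ->; left.
right; apply: derives_subst => //; apply: derives_axiom; split.
  by rewrite /is_identity /= p0 restrict0 -(eq_has_r eq_pq) -restrict0.
by exists p, q, X.
Qed.

(** * The concrete identities *)

Local Notation basis := (Gamma `|` Sigma `|` Delta).

Fixpoint words_upto (n : nat) (s : word) : seq word :=
  if n is n'.+1 then [::] :: [seq a :: w | a <- s, w <- words_upto n' s]
  else [:: [::]].

Lemma mem_words_upto n (s w : word) :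
  size w <= n -> {subset w <= s} -> w \in words_upto n s.
Proof.
elim: n w => [|n IHn] [|a w] //= le_w ws; rewrite inE /=.
apply/allpairsPdep; exists a, w; split=> //; first by rewrite ws ?mem_head.
by apply: IHn => // z zw; rewrite ws // inE zw orbT.
Qed.

(** A word with a letter outside [u ++ v] is a subword of neither side, so finitely many tests
    remain. *)
Lemma J_check m (u v : word) : is_identity (u, v) ->
  all (fun w => subseq w u == subseq w v) (words_upto m (undup (u ++ v))) ->
  J m (u, v).
Proof.
move=> id_uv /allP uv; split=> // w le_w.
have [w_uv | w_uv] := boolP (all (fun z => z \in u ++ v) w).
  by apply/eqP/uv/mem_words_upto => // z /(allP w_uv); rewrite mem_undup.
have out t : {subset t <= u ++ v} -> subseq w t = false.
  move=> tuv; apply: contraNF w_uv => /mem_subseq wt.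
  by apply/allP => z /wt /tuv.
by rewrite !out // => z zt; rewrite mem_cat zt ?orbT.
Qed.

Lemma basis_J : basis `<=` J 3.
Proof.
by move=> e [[[[|]|]|[|]]|[|]] ->; apply: J_check; vm_cast_no_check (erefl true).
Qed.

Lemma basis_double (a b : word) (x : var) : x \in a -> x \in b ->
  equivalent basis (a ++ x :: b) (a ++ [:: x, x & b]).
Proof.
case/splitPr=> a1 a2 /splitPr[b1 b2].
have := @equivalent_subst 2 basis basis_J
  [:: 0; 2; 0; 3; 0] [:: 0; 2; 0; 0; 3; 0]
  (* Images of x, y, t1, t2 in this order; y is absent from this identity, and the gaps [a2] and
     [b1] may be empty. *)
  (nth [::] [:: [:: x]; [::]; a2; b1]) a1 b2.
rewrite /subst /= -!catA /= -!catA /=; apply; by left; left; left; left.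
Qed.

Lemma basis_before (a b : word) (x y : var) : x \in a -> y \in b ->
  equivalent basis (a ++ [:: y, x, x & b]) (a ++ [:: x, y, x, x & b]).
Proof.
case/splitPr=> a1 a2 /splitPr[b1 b2].
have := @equivalent_subst 2 basis basis_J
  [:: 0; 2; 1; 0; 0; 3; 1] [:: 0; 2; 0; 1; 0; 0; 3; 1]
  (nth [::] [:: [:: x]; [:: y]; a2; b1]) a1 b2.
rewrite /subst /= -!catA /= -!catA /=; apply; by left; left; left; right.
Qed.

Lemma basis_after (a b : word) (x y : var) : y \in a -> x \in b ->
  equivalent basis (a ++ [:: x, x, y & b]) (a ++ [:: x, x, y, x & b]).
Proof.
case/splitPr=> a1 a2 /splitPr[b1 b2].
have := @equivalent_subst 2 basis basis_J
  [:: 1; 2; 0; 0; 1; 3; 0] [:: 1; 2; 0; 0; 1; 0; 3; 0]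
  (nth [::] [:: [:: x]; [:: y]; a2; b1]) a1 b2.
rewrite /subst /= -!catA /= -!catA /=; apply; by left; left; right.
Qed.

Lemma subseq2_split {x y : var} {w : word} : subseq [:: x; y] w ->
  exists w1 w2 w3, w = w1 ++ x :: w2 ++ y :: w3.
Proof.
rewrite -[[:: x; y]]/([:: x] ++ [:: y]).
elim: w => // z w IHw /=; case: eqP => [<- | _ /IHw[w1 [w2 [w3 ->]]]].
  by rewrite sub1seq => /splitPr[w2 w3]; exists [::], w2, w3.
by exists (z :: w1), w2, w3.
Qed.

Lemma basis_swap_left (a b : word) (x y : var) : subseq [:: x; y] b ->
  equivalent basis (a ++ [:: x, y, x, y & b]) (a ++ [:: y, x, y, x & b]).
Proof.
case/subseq2_split=> b1 [b2 [b3 ->]].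
have := @equivalent_subst 2 basis basis_J
  [:: 0; 1; 0; 1; 2; 0; 3; 1] [:: 1; 0; 1; 0; 2; 0; 3; 1]
  (nth [::] [:: [:: x]; [:: y]; b1; b2]) a b3.
rewrite /subst /= -!catA /= -!catA /=; apply; by left; right; left.
Qed.

Lemma basis_swap_right (a b : word) (x y : var) : subseq [:: x; y] a ->
  equivalent basis (a ++ [:: x, y, x, y & b]) (a ++ [:: y, x, y, x & b]).
Proof.
case/subseq2_split=> a1 [a2 [a3 ->]].
have := @equivalent_subst 2 basis basis_J
  [:: 0; 2; 1; 3; 0; 1; 0; 1] [:: 0; 2; 1; 3; 1; 0; 1; 0]
  (nth [::] [:: [:: x]; [:: y]; a2; a3]) a1 b.
rewrite /subst /= -!catA /= -!catA /=; apply; by left; right; right.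
Qed.

Lemma basis_insertion : insertion_theory (equivalent basis).
Proof.
split; [by left | exact: equivalent_sym | exact: equivalent_trans | | | ].
- exact: basis_double.
- exact: basis_after.
- exact: basis_swap_right.
Qed.

(** Up to renaming, reversal fixes the first identity of [Gamma], exchanges the other two, and
    exchanges those of [Sigma]. *)
Lemma basis_insertion_rev :
  insertion_theory (fun u v => equivalent basis (rev u) (rev v)).
Proof.
split; [by left | by move=> u v; apply: equivalent_sym
       | by move=> u v w; apply: equivalent_trans | | | ].
- move=> a b x xa xb; rewrite !rev_cat !rev_cons -!cats1 -!catA /=.
  by apply: basis_double; rewrite mem_rev.
- move=> a b x y ya xb; rewrite !rev_cat !rev_cons -!cats1 -!catA /=.
  by apply: basis_before; rewrite mem_rev.
- move=> a b x y xya; rewrite !rev_cat !rev_cons -!cats1 -!catA /=.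
  by apply: basis_swap_left; rewrite -subseq_rev revK.
Qed.

(** * Soundness and finiteness of the deletion closure *)

Lemma delta_J m (Theta : set identity) : Theta `<=` J m -> delta Theta `<=` J m.
Proof.
move=> ThJ e [id_e [u [v [X [/ThJ[_ uv] def_e]]]]]; split=> // w le_w.
by rewrite def_e /= /restrict !subseq_filter (uv _ le_w).
Qed.

Lemma finite_subseqs (u : word) : finite_set [set w | subseq w u].
Proof.
apply: (@sub_finite_set _ _ [set mask (val m) u | m in [set: (size u).-tuple bool]]).
  by move=> w /= /subseqP[m /eqP sz_m ->]; exists (Tuple sz_m).
exact/finite_image/finite_finset.
Qed.

(** There are infinitely many sets [X], but each restriction is one of the finitely many scattered
    subwords. *)
Lemma finite_delta (Theta : set identity) :
  finite_set Theta -> finite_set (delta Theta).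
Proof.
move=> finTh; apply: (@sub_finite_set _ _
  (\bigcup_(e in Theta) ([set w | subseq w e.1] `*` [set w | subseq w e.2]))).
  move=> _ [_ [u [v [X [uv ->]]]]]; exists (u, v) => //.
  by split; apply: filter_subseq.
by apply: bigcup_finite => // e _; apply: finite_setX; apply: finite_subseqs.
Qed.

Theorem theorem7p2 :
  finitely_based_by (J 3) (delta (Gamma `|` Sigma `|` Delta)).
Proof.
split.
- by apply: finite_delta; rewrite !finite_setU; do !split; apply: finite_set1.
- exact: delta_J basis_J.
move=> u v [/andP[u0 _] uv].
have [/= <- | //] := insertion_complete basis_insertion basis_insertion_rev uv.
exact: derives_refl.
Qed.
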